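(* Let $\varphi\in(\tfrac12,1)$ be irrational and $1<\alpha\le2$. Let $\mathcal{S}=\bigcup_{n\in\mathbb{N},\,n\ge1,\ \varphi-1/n>0}\mathcal{S}_{\varphi-\frac1n}$, where $\mathcal{S}_\psi$ denotes the set of Sturmian words generated by $\psi$. If $X$ is a Sturmian word generated by $\varphi$, then $X$ is stable with respect to $\mathcal{S}$ for the Hamiltonian $H_\alpha$; that is, for every finite set $P$ of patterns there exists $\lambda>0$ such that for every $(\lambda,P)$-perturbation $\widetilde H$ of $H_\alpha$ we have $\rho_{\widetilde H}(X)\le\rho_{\widetilde H}(W)$ for all $W\in\mathcal{S}$.
   Context: Circle $=\mathbb{R}/\mathbb{Z}$. For irrational $\psi$, $X\in\{0,1\}^{\mathbb{Z}}$ is a Sturmian word generated by $\psi$ if there are $x\in\mathbb{R}/\mathbb{Z}$ and $P_0\in\{[0,\psi),(0,\psi]\}$ with $X(n)=0$ if $x+n\psi\in P_0$ and $X(n)=1$ otherwise. Forbidden distances: $F=\{k\in\mathbb{N}: k\varphi \bmod 1\in[1-\varphi,\varphi]\}$. Fix $m\in\mathbb{N}$ such that the sequences in $\{0,1\}^{\mathbb{Z}}$ containing no $m$ consecutive $0$'s and no two $1$'s at a distance in $F$ are exactly the Sturmian words generated by $\varphi$ (such $m$ exists). A pattern is a configuration in $\{0,1\}^A$ on a finite set $A\subset\mathbb{Z}$, up to translation. A Hamiltonian is given by energies $\Phi$ on patterns; for a finite segment $w$, $H(w)$ is the sum of $\Phi(p)$ over all occurrences of patterns $p$ in $w$. $H_\alpha$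 assigns energy $1/n^\alpha$ to the pattern of two $1$'s at distance $n$ for each $n\in F$, energy $1$ to the pattern of $m$ consecutive $0$'s, and $0$ to all other patterns. Energy density: $\rho_H(X)=\liminf_{k\to\infty}\frac{H(X([-k,k]))}{2k+1}$. For a finite set of patterns $P$ and $\lambda>0$, $\widetilde H$ (energies $\widetilde\Phi$) is a $(\lambda,P)$-perturbation of $H$ (energies $\Phi$) if $|\Phi(p)-\widetilde\Phi(p)|<\lambda$ for $p\in P$ and $\Phi(q)=\widetilde\Phi(q)$ for $q\notin P$. *)

(* Defs.v *)
From HB Require Import structures.
From mathcomp Require Import all_boot all_order all_algebra.
From mathcomp Require Import all_classical all_reals all_analysis.
Set Implicit Arguments. Unset Strict Implicit. Unset Printing Implicit Defensive.
Import Order.TTheory GRing.Theory Num.Theory.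
Local Open Scope ring_scope.

Section Defs.
Variable R : realType.

Definition frac (x : R) : R := x - (Num.floor x)%:~R.


(* configurations in {0,1}^Z; false = 0, true = 1 *)
Definition config := int -> bool.

Definition sturmian (psi : R) (X : config) : Prop :=
  exists (x : R) (closed_right : bool),
    forall n : int,
      let y := frac (x + n%:~R * psi) in
      (X n = false) <->
      (if closed_right then 0 < y <= psi else 0 <= y < psi).

Definition forbidden (phi : R) (k : nat) : Prop :=
  1 - phi <= frac (k%:R * phi) <= phi.

Definition admissible (phi : R) (m : nat) (X : config) : Prop :=
  (~ exists i : int, forall j : nat, (j < m)%N -> X (i + j%:Z) = false) /\
  (forall (i : int) (n : nat), forbidden phi n -> ~ (X i /\ X (i + n%:Z))).

(* A pattern (configuration on a finite A ⊂ Z, up to translation) is encoded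
   canonically as the word over {undefined, 0, 1} spanning [min A, max A]:
   entry j is Some b if min A + j ∈ A with value b, None otherwise. *)
Definition pattern := seq (option bool).

(* the pattern of the occurrence of X on A ⊆ [-k,k]; index i : 'I_(2k+1)
   stands for the site i - k *)
Definition occ_pattern (X : config) (k : nat) (A : {set 'I_(k.*2.+1)}) : pattern :=
  let lo := \big[minn/k.*2.+1]_(i in A) val i in
  let hi := \max_(i in A) val i in
  mkseq (fun j => let t := (lo + j)%N in
           if [exists i in A, val i == t] then Some (X (t%:Z - k%:Z)) else None)
        (hi - lo).+1.

Definition energy (Phi : pattern -> R) (X : config) (k : nat) : R :=
  \sum_(A : {set 'I_(k.*2.+1)} | A != finset.set0) Phi (occ_pattern X A).

Definition density (Phi : pattern -> R) (X : config) : \bar R :=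
  limn_einf (fun k : nat => ((energy Phi X k) / (k.*2.+1)%:R)%:E).

Definition pair_pattern (n : nat) : pattern :=
  Some true :: rcons (nseq n.-1 None) (Some true).

Definition H_alpha (phi alpha : R) (m : nat) (p : pattern) : R :=
  if p == nseq m (Some false) then 1
  else if [&& (2 <= size p)%N & p == pair_pattern (size p).-1]
          && `[< forbidden phi (size p).-1 >]
       then ((size p).-1%:R `^ alpha)^-1
       else 0.

Definition perturbation (Phi Phi' : pattern -> R) (lambda : R) (P : seq pattern) : Prop :=
  (forall p, p \in P -> `|Phi p - Phi' p| < lambda) /\
  (forall q, q \notin P -> Phi q = Phi' q).

Definition S_class (phi : R) (W : config) : Prop :=
  exists n : nat, (1 <= n)%N /\ 0 < phi - n%:R^-1 /\ sturmian (phi - n%:R^-1) W.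

Definition stable (Phi : pattern -> R) (S : config -> Prop) (X : config) : Prop :=
  forall P : seq pattern, exists2 lambda : R, 0 < lambda &
    forall Phi', perturbation Phi Phi' lambda P ->
      forall W, S W -> (density Phi' X <= density Phi' W)%E.

End Defs.

(* Main.v *)
(* Along a rotation by an irrational theta, an arc of length l is visited with
   frequency l, uniformly in the starting point; hence every pattern has a
   frequency in the Sturmian words generated by theta, and moving theta by delta
   changes the frequency of a pattern of size s by O(s^2 delta). A perturbation
   of size lambda on a finite set P of patterns therefore favours a word
   generated by phi - 1/n over X by at most O(lambda / n) per site. On the other
   hand X has zero energy, while a word generated by phi - 1/n has density of
   energy at least c / n: for d of order n, with d phi just above 1 - phi modulo
   1, ones at the forbidden distance d occur with positive frequency because
   d (phi - 1/n) is closer to 0 modulo 1 than d phi, and there are about n such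
   distances, each of cost at least d^(-2). So lambda small compared with c
   suffices, uniformly in n. *)
Require Import Defs.
From HB Require Import structures.
From mathcomp Require Import all_boot all_order all_algebra.
From mathcomp Require Import all_classical all_reals all_analysis.
From mathcomp Require Import zify ring lra.
Import Defs.
Import Order.TTheory GRing.Theory Num.Theory.
Local Open Scope ring_scope.
Set Implicit Arguments. Unset Strict Implicit. Unset Printing Implicit Defensive.

(** * Irrational rotations *)

Lemma frac_def (R : realType) (x r : R) (k : int) :
  x = k%:~R + r -> 0 <= r < 1 -> frac x = r.
Proof.
move=> -> /andP[r0 r1]; rewrite /frac (@floor_def _ _ k); first lra.
by rewrite intrD; lra.
Qed.

Lemma fracE (R : realType) (x : R) : x = (Num.floor x)%:~R + frac x.
Proof. by rewrite /frac addrC subrK. Qed.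

Lemma frac_ge0 (R : realType) (x : R) : 0 <= frac x.
Proof. by rewrite subr_ge0 floor_le. Qed.

Lemma frac_lt1 (R : realType) (x : R) : frac x < 1.
Proof. by rewrite ltrBlDl; have := floorD1_gt x; rewrite intrD. Qed.

Lemma frac_itv (R : realType) (x : R) : 0 <= frac x < 1.
Proof. by rewrite frac_ge0 frac_lt1. Qed.

Lemma fracDz (R : realType) (x : R) (k : int) : frac (x + k%:~R) = frac x.
Proof.
apply: (@frac_def _ _ _ (Num.floor x + k)); last exact: frac_itv.
by rewrite intrD {1}(fracE x); lra.
Qed.

Lemma ceil_natP (R : realType) (x : R) : exists n : nat, x <= n%:R.
Proof.
exists (Num.bound `|x|); apply: le_trans (ler_norm x) _.
by apply: ltW; exact: archi_boundP.
Qed.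

Lemma irrational_nmul (R : realType) (theta : R) (k : nat) (z : int) :
  irrational theta -> (0 < k)%N -> k%:R * theta <> z%:~R.
Proof.
move=> irr k0 kz; apply: irr; apply/rationalP; exists z, k.
by rewrite -kz mulrC mulKf// pnatr_eq0 -lt0n.
Qed.

(* Pigeonhole over [Q] boxes of width [1/Q]. *)
Lemma small_multiple (R : realType) (theta e : R) : irrational theta -> 0 < e ->
  exists (k : nat) (z : int), 0 < `|k%:R * theta - z%:~R| < e.
Proof.
move=> irr e0.
have [Q Qe] := ceil_natP (e^-1 + 1).
have Q0 : 0 < Q%:R :> R by apply: lt_le_trans Qe; rewrite addr_gt0// invr_gt0.
have Q0' : (0 < Q)%N by rewrite -(ltr_nat R).
have box (k : nat) : (`|Num.floor (Q%:R * frac (k%:R * theta))| < Q)%N.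
  have f0 : 0 <= Num.floor (Q%:R * frac (k%:R * theta)).
    by rewrite floor_ge0 mulr_ge0// ?frac_ge0// ltW.
  rewrite -(ltr_nat R) natr_absz ger0_norm//.
  apply: le_lt_trans (floor_le _) _.
  by rewrite gtr_pMr// frac_lt1.
pose f (k : 'I_Q.+1) := Ordinal (box k).
have /injectivePn[a [b ab fab]] : ~~ injectiveb f.
  by apply/injectiveP => /leq_card; rewrite !card_ord ltnn.
wlog lt_ab : a b ab fab / (a < b)%N.
  move=> H; case: (ltngtP a b) => [lt|gt|/val_inj eq].
  - exact: (H a b).
  - by apply: (H b a) => //; rewrite eq_sym.
  - by rewrite eq eqxx in ab.
have {}fab : Num.floor (Q%:R * frac (a%:R * theta)) =
    Num.floor (Q%:R * frac (b%:R * theta)).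
  move/(congr1 val): fab => /= /(congr1 Posz).
  by rewrite !gez0_abs// floor_ge0 mulr_ge0// ?frac_ge0// ltW.
have := floor_itv (Q%:R * frac (a%:R * theta)).
have := floor_itv (Q%:R * frac (b%:R * theta)).
rewrite -fab; set w := Num.floor (Q%:R * _); rewrite intrD => /andP[b1 b2] /andP[a1 a2].
exists (b - a)%N, (Num.floor (b%:R * theta) - Num.floor (a%:R * theta)).
have E : (b - a)%:R * theta
  - (Num.floor (b%:R * theta) - Num.floor (a%:R * theta))%:~R
  = frac (b%:R * theta) - frac (a%:R * theta).
  by rewrite natrB ?(ltnW lt_ab)// intrB /frac; lra.
rewrite normr_gt0 subr_eq0; apply/andP; split.
  by apply/eqP; apply: irrational_nmul => //; rewrite subn_gt0.
rewrite E; have Qd : Q%:R * `|frac (b%:R * theta) - frac (a%:R * theta)| < 1.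
  rewrite -[X in X * _]gtr0_norm// -normrM mulrBr ltr_norml.
  by apply/andP; split; lra.
rewrite -(ltr_pM2l Q0); apply: lt_trans Qd _.
rewrite -(@ltr_pM2r _ e^-1) ?invr_gt0//.
by rewrite mul1r mulfK ?gt_eqF//; lra.
Qed.

(** Some [m] rotations together make a nonzero step [g] shorter than [e]. A walk with this step
    cannot jump over [[0, e)] and reaches it within about [1/|g|] steps from any [y], so [L] does
    not depend on [y]. *)
Lemma rotation_dense (R : realType) (theta e : R) : irrational theta -> 0 < e ->
  exists L : nat, forall y : R, exists2 k, (k < L)%N & frac (y + k%:R * theta) < e.
Proof.
move=> irr e0.
have e10 : 0 < Num.min e 1 by rewrite lt_min e0 ltr01.
have [m [z]] := small_multiple irr e10.
set g := _ - _; rewrite lt_min => /and3P[g0 ge g1].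
have mg j : (j * m)%N%:R * theta = (j%:Z * z)%:~R + j%:R * g.
  by rewrite /g natrM intrM mulrBr -mulrA -pmulrn; lra.
have [J Jg] := ceil_natP (`|g|^-1 + 1).
have {}Jg : 1 + `|g| <= J%:R * `|g|.
  have := ler_wpM2r (ltW g0) Jg; rewrite mulrDl mul1r mulVf ?gt_eqF//.
exists (J * m).+1 => y.
(* For [g > 0] the walk stops at its first step beyond the next integer; for [g < 0], at its last
   step before crossing the integer below. *)
have [gpos|gneg] := ltP 0 g.
  rewrite gtr0_norm// in g0 ge g1 Jg.
  pose q := (1 - frac y) / g.
  have q0 : 0 <= q by apply: divr_ge0; [rewrite subr_ge0 ltW// frac_lt1|exact: ltW].
  pose j := (Num.truncn q).+1.
  have : (Num.truncn q)%:R <= q < (Num.truncn q).+1%:R by rewrite truncn_itv.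
  rewrite /q -natr1 ler_pdivlMr// ltr_pdivrMr// => /andP[j1 j2].
  have jJ : (j <= J)%N.
    rewrite -(ler_nat R) -(ler_pM2r g0) /j -natr1; have := frac_ge0 y; lra.
  exists (j * m)%N; first by rewrite ltnS leq_mul2r jJ orbT.
  rewrite mg (@frac_def _ _ (frac y + j%:R * g - 1)
    (Num.floor y + 1 + j%:Z * z)); last 2 first.
  - have := fracE y; rewrite 2!intrD mulr1z; lra.
  - rewrite /j -natr1; apply/andP; split; lra.
  by rewrite /j -natr1; lra.
rewrite ler0_norm// in g0 ge g1 Jg.
pose q := frac y / - g.
have q0 : 0 <= q by apply: divr_ge0; [exact: frac_ge0|exact: ltW].
pose j := Num.truncn q.
have : (Num.truncn q)%:R <= q < (Num.truncn q).+1%:R by rewrite truncn_itv.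
rewrite -/j /q -natr1 ler_pdivlMr// ltr_pdivrMr// => /andP[j1 j2].
have jJ : (j <= J)%N.
  rewrite -(ler_nat R) -(ler_pM2r g0); have := frac_lt1 y; lra.
exists (j * m)%N; first by rewrite ltnS leq_mul2r jJ orbT.
have fy := frac_lt1 y.
rewrite mg (@frac_def _ _ (frac y + j%:R * g)
  (Num.floor y + j%:Z * z)); last 2 first.
- have := fracE y; rewrite intrD; lra.
- apply/andP; split; lra.
by lra.
Qed.

(** * Frequency of visits to an arc *)

Lemma sum_const_ord (R : realType) (c : R) (N : nat) :
  \sum_(i < N) c = c * N%:R.
Proof. by rewrite sumr_const card_ord mulr_natr. Qed.

Lemma sum_shift_le (R : realType) (h : nat -> R) (N k : nat) :
  (forall i, 0 <= h i <= 1) ->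
  \sum_(i < N) h i <= \sum_(i < N) h (k + i)%N + k%:R.
Proof.
move=> h01; have le1 : \sum_(i < N) h i <= \sum_(i < k + N) h i.
  rewrite addnC big_split_ord /= lerDl sumr_ge0// => i _.
  by have /andP[] := h01 (N + i)%N.
apply: le_trans le1 _; rewrite big_split_ord /= addrC lerD2l.
apply: le_trans (ler_sum _ (G := fun=> 1) _) _.
  by move=> i _; have /andP[] := h01 i.
by rewrite sum_const_ord mul1r.
Qed.

(* Moving the starting point along the orbit costs a bounded amount, and moving
   it right by [t] raises each fractional part by at most [t]. *)
Lemma sum_frac_equi (R : realType) (theta e : R) : irrational theta -> 0 < e ->
  exists N0 : nat, forall N, (N0 <= N)%N -> forall u v,
  \sum_(i < N) frac (u + i%:R * theta) <=
  \sum_(i < N) frac (v + i%:R * theta) + e * N%:R.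
Proof.
move=> irr e0; have e20 : 0 < e / 2 by rewrite divr_gt0.
have [L Lp] := rotation_dense irr e20.
have [N0 N0e] := ceil_natP (L%:R / (e / 2)).
exists N0 => N NN u v.
have [k kL] := Lp (u - v); set t := frac _ => te.
have LN : L%:R <= e / 2 * N%:R.
  rewrite -ler_pdivrMl// mulrC; apply: le_trans N0e _.
  by rewrite ler_nat.
have kLR : k%:R <= L%:R :> R by rewrite ler_nat ltnW.
apply: le_trans (sum_shift_le (h := fun i => frac (u + i%:R * theta)) N k _) _.
  by move=> i; rewrite frac_ge0 ltW// frac_lt1.
have : \sum_(i < N) frac (u + (k + i)%:R * theta) <=
    \sum_(i < N) (frac (v + i%:R * theta) + e / 2).
  apply: ler_sum => i _.
  have [f1 f2] : 0 <= frac (v + i%:R * theta) /\ frac (v + i%:R * theta) < 1.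
    by rewrite frac_ge0 frac_lt1.
  have t0 : 0 <= t by exact: frac_ge0.
  have Et := fracE (u - v + k%:R * theta); rewrite -/t in Et.
  have -> : u + (k + i)%:R * theta =
     v + i%:R * theta + t + (Num.floor (u - v + k%:R * theta))%:~R.
    by rewrite natrD; lra.
  rewrite fracDz; have [lt1|ge1] := ltP (frac (v + i%:R * theta) + t) 1.
    rewrite (@frac_def _ _ (frac (v + i%:R * theta) + t)
      (Num.floor (v + i%:R * theta))); first by lra.
      by have := fracE (v + i%:R * theta); lra.
    by apply/andP; split; lra.
  (* After a wrap-around the fractional part is below 1, hence below
     [frac (v + i%:R * theta) + t]. *)
  by have := frac_lt1 (v + i%:R * theta + t); lra.
rewrite [leRHS]big_split /= sum_const_ord; lra.
Qed.

(** Stepping back by [l] wraps around exactly when [frac v < l]. In this form, counting visits to an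
    arc reduces to comparing sums of fractional parts from two starting points. *)
Lemma arc_indicator (R : realType) (l v : R) : 0 < l <= 1 ->
  (frac v < l)%R%:R = l + frac (v - l) - frac v.
Proof.
move=> /andP[l0 l1]; have := frac_itv v; have Ev := fracE v => /andP[f0 f1].
case: ltP => fl; rewrite /= ?mulr1n ?mulr0n.
  rewrite (@frac_def _ (v - l) (frac v - l + 1) (Num.floor v - 1)); first lra.
    by rewrite intrB mulr1z; lra.
  by apply/andP; split; lra.
rewrite (@frac_def _ (v - l) (frac v - l) (Num.floor v)); [lra|lra|].
by apply/andP; split; lra.
Qed.

Lemma arc_count (R : realType) (theta e : R) : irrational theta -> 0 < e ->
  exists N0 : nat, forall N, (N0 <= N)%N -> forall u l, 0 < l <= 1 ->
  (l - e) * N%:R <= \sum_(i < N) (frac (u + i%:R * theta) < l)%R%:R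
    <= (l + e) * N%:R.
Proof.
move=> irr e0; have [N0 N0p] := sum_frac_equi irr e0.
exists N0 => N NN u l l01.
have -> : \sum_(i < N) (frac (u + i%:R * theta) < l)%R%:R = l * N%:R
  + \sum_(i < N) frac (u - l + i%:R * theta)
  - \sum_(i < N) frac (u + i%:R * theta).
  rewrite -sumrN -sum_const_ord.
  rewrite -!big_split /=; apply: eq_bigr => i _.
  by rewrite arc_indicator// (addrAC u).
by apply/andP; split; have := N0p _ NN u (u - l); have := N0p _ NN (u - l) u; lra.
Qed.

(** This covers closed arcs, from single points to lengths beyond the circle: the arc is widened by
    [e / 2] to a half-open one, and the trivial bound takes over once this exceeds the circle. *)
Lemma arc_count_le (R : realType) (theta e : R) : irrational theta -> 0 < e ->
  exists N0 : nat, forall N, (N0 <= N)%N -> forall u l, 0 <= l ->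
  \sum_(i < N) (frac (u + i%:R * theta) <= l)%R%:R <= (l + e) * N%:R.
Proof.
move=> irr e0; have e20 : 0 < e / 2 by rewrite divr_gt0.
have [N0 N0p] := arc_count irr e20; exists N0 => N NN u l l0.
have [l1|l1] := lerP (l + e / 2) 1.
  have l01 : 0 < l + e / 2 <= 1 by rewrite l1 andbT; lra.
  have /andP[_] := N0p N NN u _ l01.
  have -> : l + e / 2 + e / 2 = l + e by lra.
  apply: le_trans; apply: ler_sum => i _; rewrite ler_nat.
  have : frac (u + i%:R * theta) <= l -> frac (u + i%:R * theta) < l + e / 2.
    by lra.
  by case: (_ <= l)%R; case: (_ < l + _)%R => // /(_ isT).
apply: le_trans (ler_sum _ (G := fun=> 1) _) _ => [i _|].
  by rewrite lern1 leq_b1.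
rewrite sum_const_ord ler_wpM2r//; lra.
Qed.

(** * Pattern frequencies along a rotation *)

(* The letter of a Sturmian word at circle position [y]; [c] selects the zero
   interval [(0, theta]] rather than [[0, theta)]. *)
Definition letter (R : realType) (theta : R) (c : bool) (y : R) : bool :=
  ~~ (if c then 0 < frac y <= theta else 0 <= frac y < theta).

Definition hit (R : realType) (theta : R) (c : bool) (p : pattern) (y : R) : bool :=
  all (fun j => if nth None p j is Some b then letter theta c (y + j%:R * theta) == b
                else true) (iota 0 (size p)).

Lemma letterDz (R : realType) (theta : R) c y (k : int) :
  letter theta c (y + k%:~R) = letter theta c y.
Proof. by rewrite /letter fracDz. Qed.

Lemma hitDz (R : realType) (theta : R) c p y (k : int) :
  hit theta c p (y + k%:~R) = hit theta c p y.
Proof.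
rewrite /hit; apply: eq_all => j; case: (nth None p j) => // b.
by rewrite addrAC letterDz.
Qed.

(** The letter is 0 when an integer separates [y - theta] from [y]. As neither point is an integer,
    the choice [c] of the endpoint does not matter. *)
Lemma letter_floor (R : realType) (theta : R) c (y : R) (F G : int) :
  F%:~R < y < F%:~R + 1 -> G%:~R < y - theta < G%:~R + 1 ->
  letter theta c y = ~~ (G < F).
Proof.
move=> /andP[F1 F2] /andP[G1 G2].
rewrite /letter (@frac_def _ _ (y - F%:~R) F); [|lra|by apply/andP; split; lra].
congr negb; have [GF|FG] := ltP G F.
  have : (G + 1)%:~R <= F%:~R :> R by rewrite ler_int; lia.
  by rewrite intrD => ?; case: c; apply/andP; split; lra.
have : F%:~R <= G%:~R :> R by rewrite ler_int.
by move=> ?; case: c; apply/negbTE/negP => /andP[]; lra.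
Qed.

(* [y] is within [d] of [0] or of [theta] modulo 1. *)
Definition near_ends (R : realType) (theta d y : R) : bool :=
  (frac (y + d) <= 2 * d) || (frac (y - theta + d) <= 2 * d).

(** [frac (y + d) > 2 * d] puts the whole [d]-neighbourhood of [y] strictly between consecutive
    integers, and likewise for [y - theta]. So both floors survive the move to [z] and [theta']. *)
Lemma letter_near_ends (R : realType) (theta theta' d y z : R) c c' :
  `|z - y| <= d -> `|(z - theta') - (y - theta)| <= d ->
  ~~ near_ends theta d y -> letter theta c y = letter theta' c' z.
Proof.
rewrite !ler_norml => /andP[zy1 zy2] /andP[zt1 zt2].
rewrite negb_or -!ltNge => /andP[n1 n2].
have := fracE (y + d); have := frac_lt1 (y + d).
have := fracE (y - theta + d); have := frac_lt1 (y - theta + d).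
set F := Num.floor (y + d); set G := Num.floor (y - theta + d) => a1 a2 a3 a4.
rewrite (@letter_floor _ theta c y F G); [|apply/andP; split; lra..].
by rewrite (@letter_floor _ theta' c' z F G); [|apply/andP; split; lra..].
Qed.

(** A union bound: the two matches can differ only if some letter is read near an endpoint, and then
    the sum is at least 1. *)
Lemma hit_near_ends (R : realType) (theta theta' e e' y z : R) c c' p :
  `|z - y| <= e -> `|theta' - theta| <= e' ->
  (hit theta c p y)%:R <= (hit theta' c' p z)%:R +
    \sum_(j < size p) (near_ends theta (e + (size p)%:R * e') (y + j%:R * theta))%:R
  :> R.
Proof.
move=> zy tt; set d := e + _; set S := \sum_(j < _) _.
have S0 : 0 <= S by apply: sumr_ge0.
have [/existsP[j nj]|/existsPn none] :=
    boolP [exists j : 'I_(size p), near_ends theta d (y + j%:R * theta)].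
  have : 1 <= S by rewrite /S (bigD1 j)//= nj lerDl sumr_ge0.
  by case: (hit _ _ _ y); case: (hit _ _ _ z); rewrite /= ?mulr1n ?mulr0n; lra.
suff -> : hit theta c p y = hit theta' c' p z by rewrite lerDl.
apply: eq_in_all => j; rewrite mem_iota /= add0n => jp.
case: (nth None p j) => // b; congr (_ == b).
have e'0 : 0 <= e' := le_trans (normr_ge0 _) tt.
(* The position of letter [j] drifts by [j * e'] and the endpoint [theta] moves by one more [e']. *)
have jp1 : j.+1%:R * e' <= (size p)%:R * e' by rewrite ler_wpM2r// ler_nat.
rewrite -natr1 mulrDl mul1r in jp1.
have jt : `|j%:R * theta' - j%:R * theta| <= j%:R * e'.
  by rewrite -mulrBr normrM ger0_norm// ler_wpM2l.
move: zy tt jt; rewrite !ler_norml => /andP[? ?] /andP[? ?] /andP[? ?].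
apply: (@letter_near_ends _ _ _ d); last exact: (none (Ordinal jp)).
  by rewrite ler_norml; apply/andP; split; rewrite /d; lra.
by rewrite ler_norml; apply/andP; split; rewrite /d; lra.
Qed.

(** For each of the [s] offsets there are two arcs of length [2 * d], each counted with error
    [e / 2]. *)
Lemma near_ends_count (R : realType) (theta e : R) (s : nat) :
  irrational theta -> 0 < e ->
  exists N0 : nat, forall N, (N0 <= N)%N -> forall u d, 0 <= d ->
  \sum_(i < N) \sum_(j < s) (near_ends theta d (u + i%:R * theta + j%:R * theta))%:R
    <= s%:R * (4 * d + e) * N%:R.
Proof.
move=> irr e0; have e20 : 0 < e / 2 by rewrite divr_gt0.
have [N0 N0p] := arc_count_le irr e20; exists N0 => N NN u d d0.
have d20 : 0 <= 2 * d by rewrite mulr_ge0.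
rewrite exchange_big /=.
apply: le_trans (ler_sum _ (G := fun=> (4 * d + e) * N%:R) _) _ => [j _|].
  have := N0p N NN (u + j%:R * theta + d) _ d20.
  have := N0p N NN (u + j%:R * theta - theta + d) _ d20.
  set A := \sum_(i < N) _; set B := \sum_(i < N) _ => A1 B1.
  suff : \sum_(i < N)
    (near_ends theta d (u + i%:R * theta + j%:R * theta))%:R <= A + B by lra.
  rewrite /A /B -big_split /=; apply: ler_sum => i _.
  rewrite -natrD ler_nat /near_ends.
  have -> : u + i%:R * theta + j%:R * theta + d =
    u + j%:R * theta + d + i%:R * theta by lra.
  have -> : u + i%:R * theta + j%:R * theta - theta + d =
    u + j%:R * theta - theta + d + i%:R * theta by lra.
  by do 2 case: (frac _ <= _).
by rewrite sum_const_ord; lra.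
Qed.

(** A bounded number of rotations brings [u] within [d] of [v] modulo 1. From then on the orbits
    stay that close, and matches differ only at visits near the endpoints. *)
Lemma hit_equi (R : realType) (theta e : R) p : irrational theta -> 0 < e ->
  exists N0 : nat, forall N, (N0 <= N)%N -> forall u v c c',
  \sum_(i < N) (hit theta c p (u + i%:R * theta))%:R <=
  \sum_(i < N) (hit theta c' p (v + i%:R * theta))%:R + e * N%:R.
Proof.
move=> irr e0; pose s := size p.
have s0 : 0 < (s.+1)%:R :> R by rewrite ltr0n.
(* Half of [e] pays for the visits near the endpoints, of frequency [s * (4 * d + d)], the other
   half for the initial shift. Using [s.+1] keeps the denominator positive for the empty pattern. *)
pose d := e / (10 * s.+1%:R).
have d0 : 0 < d by rewrite divr_gt0// mulr_gt0.
have ds : s%:R * (5 * d) <= e / 2.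
  have -> : s%:R * (5 * d) = e / 2 * (s%:R / s.+1%:R) by rewrite /d; field; rewrite gt_eqF.
  rewrite ger_pMr ?divr_gt0// ler_pdivrMr// mul1r ler_nat//.
have [L Lp] := rotation_dense irr d0.
have [N1 N1p] := near_ends_count s irr d0.
have e20 : 0 < e / 2 by rewrite divr_gt0.
have [N0 N0e] := ceil_natP (L%:R / (e / 2)).
exists (maxn N0 N1) => N; rewrite geq_max => /andP[NN0 NN1] u v c c'.
have [k kL] := Lp (u - v); set t := frac _ => td.
have t0 : 0 <= t by exact: frac_ge0.
have LN : L%:R <= e / 2 * N%:R.
  rewrite -ler_pdivrMl// mulrC; apply: le_trans N0e _.
  by rewrite ler_nat.
have kLR : k%:R <= L%:R :> R by rewrite ler_nat ltnW.
apply: le_trans (sum_shift_le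
  (h := fun i => (hit theta c p (u + i%:R * theta))%:R) N k _) _.
  by move=> i; rewrite ler0n lern1 leq_b1.
have Nr0 : 0 <= N%:R :> R by [].
have near := N1p N NN1 (v + t) d (ltW d0).
have dsN := ler_wpM2r Nr0 ds.
rewrite (_ : 4 * d + d = 5 * d) in near; last by lra.
suff : \sum_(i < N) (hit theta c p (u + (k + i)%:R * theta))%:R <=
    \sum_(i < N) ((hit theta c' p (v + i%:R * theta))%:R +
    \sum_(j < s) (near_ends theta d (v + t + i%:R * theta + j%:R * theta))%:R) :> R.
  by rewrite big_split /=; lra.
apply: ler_sum => i _.
have Et := fracE (u - v + k%:R * theta); rewrite -/t in Et.
have -> : u + (k + i)%:R * theta =
   v + t + i%:R * theta + (Num.floor (u - v + k%:R * theta))%:~R.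
  by rewrite natrD; lra.
rewrite hitDz.
have -> : d = d + (size p)%:R * 0 by rewrite mulr0 addr0.
apply: hit_near_ends; last by rewrite subrr normr0.
by rewrite ler_norml; apply/andP; split; lra.
Qed.

(* A double average: the sum over [i] along [theta'] makes the count at the
   starting point [v + i theta'] comparable with the one at [v], and for each
   fixed starting point only the rotation by [theta] is involved. *)
Lemma hit_compare (R : realType) (theta theta' e : R) p :
  irrational theta -> irrational theta' -> 0 < e ->
  exists N0 : nat, forall N, (N0 <= N)%N -> forall u v c c',
  \sum_(i < N) (hit theta c p (u + i%:R * theta))%:R <=
  \sum_(i < N) (hit theta' c' p (v + i%:R * theta'))%:R +
  (4 * (size p)%:R ^+ 2 * `|theta' - theta| + e) * N%:R.
Proof.
move=> irr irr' e0; pose s := size p.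
have s0 : 0 < (s.+1)%:R :> R by rewrite ltr0n.
have e30 : 0 < e / 3 by rewrite divr_gt0.
pose d := e / (3 * s.+1%:R).
have d0 : 0 < d by rewrite divr_gt0// mulr_gt0.
have ds : s%:R * d <= e / 3.
  have -> : s%:R * d = e / 3 * (s%:R / s.+1%:R) by rewrite /d; field; rewrite gt_eqF.
  rewrite ger_pMr ?divr_gt0// ler_pdivrMr// mul1r ler_nat//.
have [N1 N1p] := hit_equi p irr e30.
have [N2 N2p] := hit_equi p irr' e30.
have [N3 N3p] := near_ends_count s irr d0.
exists (maxn 1 (maxn N1 (maxn N2 N3))) => N.
rewrite !geq_max => /and4P[N0 NN1 NN2 NN3] u v c c'.
have Nr0 : 0 < N%:R :> R by rewrite ltr0n.
set D := `|theta' - theta|; have D0 : 0 <= D by exact: normr_ge0.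
(* After multiplication by [N] the left side is a sum of [N] equal terms; the [i]-th one is moved to
   the starting point [v + i theta']. *)
rewrite -(ler_pM2l Nr0) mulrC -sum_const_ord.
apply: le_trans (ler_sum _ (G := fun i : 'I_N =>
  \sum_(r < N) (hit theta c p (v + i%:R * theta' + r%:R * theta))%:R
  + e / 3 * N%:R) _) _ => [i _|].
  exact: N1p.
rewrite big_split /= sum_const_ord.
have step2 (i : nat) :
    \sum_(r < N) (hit theta c p (v + i%:R * theta' + r%:R * theta))%:R <=
    \sum_(r < N) (hit theta' c' p (v + r%:R * theta + i%:R * theta'))%:R
    + s%:R * (4 * (s%:R * D) + d) * N%:R.
  have sD0 : 0 <= s%:R * D by rewrite mulr_ge0.
  apply: le_trans _ (lerD (lexx _) (N3p N NN3 (v + i%:R * theta') _ sD0)).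
  rewrite -big_split /=; apply: ler_sum => r _.
  rewrite (addrAC v) -[s%:R * D]add0r; apply: hit_near_ends; last exact: lexx.
  by rewrite addrAC subrr normr0.
have H1 := ler_sum (index_enum 'I_N) (fun (i : 'I_N) (_ : true) => step2 i).
rewrite [leRHS]big_split /= sum_const_ord [X in _ <= X + _]exchange_big /= in H1.
have H2 : \sum_(r < N)
    \sum_(i < N) (hit theta' c' p (v + r%:R * theta + i%:R * theta'))%:R <=
  \sum_(r < N) (\sum_(i < N) (hit theta' c' p (v + i%:R * theta'))%:R + e / 3 * N%:R).
  by apply: ler_sum => r _; exact: N2p.
rewrite sum_const_ord in H2.
have H3 : (s%:R * d) * N%:R * N%:R <= e / 3 * N%:R * N%:R.
  by rewrite !ler_pM2r.
move: H1 H2 H3; rewrite -/s.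
set A := \sum_(r < N) \sum_(i < N) _; set B := \sum_(i < N) \sum_(r < N) _.
by set C := \sum_(i < N) _; lra.
Qed.

(** * Occurrences of patterns *)

Local Arguments occ_pattern : simpl never.

(* The words that encode a pattern; the other words never occur. *)
Definition canonical (p : pattern) : bool :=
  (nth None p 0 != None) && (nth None p (size p).-1 != None).

Definition occurs (X : config) (p : pattern) (i : int) : bool :=
  all (fun j => if nth None p j is Some b then X (i + j%:Z) == b else true)
    (iota 0 (size p)).

Definition first_site (n : nat) (A : {set 'I_n}) : nat :=
  \big[minn/n]_(i in A) val i.

(** Together with [first_site] this inverts [occ_pattern], so that counting sets of sites becomes
    counting positions. *)
Definition pattern_sites (n : nat) (p : pattern) (t : nat) : {set 'I_n} :=
  [set i : 'I_n | (t <= i)%N && (nth None p (i - t) != None)].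

Lemma first_site_le (n : nat) (A : {set 'I_n}) (i : 'I_n) :
  i \in A -> (first_site A <= i)%N.
Proof.
move=> iA; rewrite /first_site -big_filter.
have : i \in [seq j <- index_enum 'I_n | j \in A] by rewrite mem_filter iA mem_index_enum.
elim: (seq.filter _ _) => // j s IH; rewrite inE big_cons => /predU1P[->|/IH ji].
  exact: geq_minl.
exact: leq_trans (geq_minr _ _) ji.
Qed.

Lemma first_site_eq (n : nat) (A : {set 'I_n}) (i : 'I_n) :
  i \in A -> (forall j, j \in A -> (i <= j)%N) -> first_site A = i.
Proof.
move=> iA min_i; apply/eqP; rewrite eqn_leq first_site_le//=.
rewrite /first_site; elim/big_ind: _ => //; first exact: ltnW.
by move=> x y ix iy; rewrite leq_min ix iy.
Qed.

Lemma first_site_mem (n : nat) (A : {set 'I_n}) :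
  A != finset.set0 -> exists2 i : 'I_n, i \in A & first_site A = i.
Proof.
case/set0Pn => i0 i0A; case: (arg_minnP (fun i : 'I_n => val i) i0A) => i iA min_i.
by exists i => //; apply: first_site_eq.
Qed.

Lemma nth_occ_pattern (X : config) (k : nat) (A : {set 'I_(k.*2.+1)}) j :
  nth None (occ_pattern X A) j =
  if [exists i in A, val i == (first_site A + j)%N]
  then Some (X ((first_site A)%:Z - k%:Z + j%:Z)) else None.
Proof.
rewrite /occ_pattern -/(first_site A).
set hi := \max_(i in A) val i; have [js|js] := ltnP j (hi - first_site A).+1.
  by rewrite nth_mkseq// PoszD addrAC.
rewrite nth_default ?size_mkseq//; case: existsP => // -[i /andP[iA /eqP ij]].
have : (i <= hi)%N by exact: (leq_bigmax_cond (F := val)).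
by rewrite ij => hij; exfalso; move: js hij; lia.
Qed.

Lemma size_occ_pattern (X : config) (k : nat) (A : {set 'I_(k.*2.+1)}) :
  A != finset.set0 ->
  exists2 i : 'I_(k.*2.+1), i \in A & (first_site A + size (occ_pattern X A))%N = i.+1.
Proof.
move=> A0; have [i0 i0A ei0] := first_site_mem A0.
have cA : (0 < #|A|)%N by rewrite card_gt0.
have [i iA ei] := eq_bigmax_cond (fun i : 'I_(k.*2.+1) => val i) cA.
exists i => //; rewrite size_mkseq -/(first_site A) ei.
have := first_site_le iA; rewrite /=; lia.
Qed.

Lemma occ_patternP (X : config) (k : nat) (A : {set 'I_(k.*2.+1)}) :
  A != finset.set0 ->
  [/\ A = pattern_sites k.*2.+1 (occ_pattern X A) (first_site A),
      (first_site A + size (occ_pattern X A) <= k.*2.+1)%N,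
      canonical (occ_pattern X A) &
      occurs X (occ_pattern X A) ((first_site A)%:Z - k%:Z)].
Proof.
move=> A0; have [i0 i0A ei0] := first_site_mem A0.
have [i1 i1A ei1] := size_occ_pattern X A0.
split.
- apply/setP => i; rewrite inE nth_occ_pattern; apply/idP/andP => [iA|[li]].
    split; first exact: first_site_le.
    rewrite subnKC ?first_site_le//; case: existsP => // -[]; exists i.
    by rewrite iA eqxx.
  rewrite subnKC//; case: existsP => // -[i' /andP[iA /eqP /val_inj <-]].
  by [].
- by rewrite ei1.
- rewrite /canonical !nth_occ_pattern addn0; apply/andP; split.
    by case: existsP => // -[]; exists i0; rewrite i0A ei0 eqxx.
  case: existsP => // -[]; exists i1; rewrite i1A andTb.
  have sz : (0 < size (occ_pattern X A))%N by rewrite size_mkseq.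
  have -> : (first_site A + (size (occ_pattern X A)).-1)%N = i1 by lia.
  exact: eqxx.
- apply/allP => j _; rewrite nth_occ_pattern.
  by case: [exists i in A, _].
Qed.

(** Converse of [occ_patternP]: the end entries of a canonical word are defined, so the leftmost
    site is [t] and the sites span the length of [p]. *)
Lemma pattern_sitesP (X : config) (k : nat) (p : pattern) (t : nat) :
  canonical p -> (t + size p <= k.*2.+1)%N -> occurs X p (t%:Z - k%:Z) ->
  [/\ pattern_sites k.*2.+1 p t != finset.set0,
      first_site (pattern_sites k.*2.+1 p t) = t &
      occ_pattern X (pattern_sites k.*2.+1 p t) = p].
Proof.
move=> /andP[p0 p1] tk occ; set A := pattern_sites _ _ _.
have sp : (0 < size p)%N by case: (p) p0.
have t0 : (t < k.*2.+1)%N by lia.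
have t1 : (t + (size p).-1 < k.*2.+1)%N by lia.
have m0 : Ordinal t0 \in A by rewrite inE /= leqnn subnn.
have m1 : Ordinal t1 \in A by rewrite inE /= leq_addr addKn.
have A0 : A != finset.set0 by apply/set0Pn; exists (Ordinal t0).
have ft : first_site A = t.
  by apply: (first_site_eq m0) => j; rewrite inE => /andP[].
split=> //; have [i1 i1A ei1] := size_occ_pattern X A0.
have sz : size (occ_pattern X A) = size p.
  have lt i : i \in A -> (i < t + size p)%N.
    rewrite inE => /andP[ti]; apply: contraNT; rewrite -leqNgt => pi.
    by rewrite nth_default//; lia.
  have := lt _ i1A; rewrite ft in ei1.
  have : (t + (size p).-1 < i1.+1)%N.
    have [A1 _ _ _] := occ_patternP X A0.
    move: m1; rewrite {1}A1 ft inE /= leq_addr addKn -ei1.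
    by apply: contraNT; rewrite -leqNgt => ?; rewrite nth_default//; lia.
  lia.
apply: (@eq_from_nth _ None) => // j; rewrite sz => jp.
rewrite nth_occ_pattern ft.
have tj : (t + j < k.*2.+1)%N by lia.
have := allP occ j; rewrite mem_iota /= add0n => /(_ jp).
case pj : (nth None p j) => [b|] => [/eqP ->|_].
  case: existsP => // -[]; exists (Ordinal tj).
  by rewrite inE /= leq_addr addKn pj eqxx.
case: existsP => // -[i /andP[+ /eqP ij]].
by rewrite inE ij addKn pj andbF.
Qed.

Definition occ_count (X : config) (k : nat) (p : pattern) : nat :=
  #|[set A : {set 'I_(k.*2.+1)} | (A != finset.set0) && (occ_pattern X A == p)]|.

Lemma occ_count_canonical (X : config) (k : nat) (p : pattern) : canonical p ->
  occ_count X k p =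
  (\sum_(t < k.*2.+2 - size p) (occurs X p (t%:Z - k%:Z)%R : nat))%N.
Proof.
move=> cp; have sp : (0 < size p)%N by case/andP: cp; case: (p).
pose T := [set t : 'I_(k.*2.+1) | (t + size p <= k.*2.+1)%N &&
                                  occurs X p (t%:Z - k%:Z)].
have -> : occ_count X k p = #|(fun t : 'I_(k.*2.+1) => pattern_sites k.*2.+1 p t) @: T|.
  congr #|pred_of_set _|; apply/setP => A; rewrite inE.
  apply/andP/imsetP => [[A0 /eqP eA]|[t + ->]].
    have [eqA szA _ oA] := occ_patternP X A0; rewrite eA in eqA szA oA.
    have [i _ ei] := first_site_mem A0.
    by exists i; rewrite ?inE -ei ?szA ?oA.
  by rewrite inE => /andP[ts ot]; have [? _ ->] := pattern_sitesP cp ts ot.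
rewrite card_in_imset; last first.
  move=> t t'; rewrite !inE => /andP[ts ot] /andP[ts' ot'] /(congr1 (@first_site _)).
  have [_ -> _] := pattern_sitesP cp ts ot.
  by have [_ -> _] := pattern_sitesP cp ts' ot' => /val_inj.
rewrite cardsE -sum1_card.
rewrite (big_ord_widen k.*2.+1 (fun t => occurs X p (t%:Z - k%:Z) : nat)); last by lia.
rewrite big_mkcond [RHS]big_mkcond /=; apply: eq_bigr => t _.
have -> : (t \in fun t : 'I__ => (t + size p <= k.*2.+1)%N && occurs X p (t%:Z - k%:Z))
  = (t + size p <= k.*2.+1)%N && occurs X p (t%:Z - k%:Z) by [].
have -> : (t < k.*2.+2 - size p)%N = (t + size p <= k.*2.+1)%N by lia.
by case: (_ <= _)%N => //=; case: occurs.
Qed.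

Lemma occ_count_noncanonical (X : config) (k : nat) (p : pattern) :
  ~~ canonical p -> occ_count X k p = 0%N.
Proof.
move=> ncp; apply/eqP; rewrite cards_eq0; apply/eqP/setP => A; rewrite !inE.
apply/negP => /andP[A0 /eqP eA]; have [_ _ + _] := occ_patternP X A0.
by rewrite eA (negbTE ncp).
Qed.

Lemma sum_occ_count (R : realType) (X : config) (k : nat) (p : pattern) :
  \sum_(A : {set 'I_(k.*2.+1)} | A != finset.set0) (occ_pattern X A == p)%:R
  = (occ_count X k p)%:R :> R.
Proof.
rewrite -natr_sum; congr (_%:R); rewrite /occ_count -sum1_card.
rewrite big_mkcond [RHS]big_mkcond /=; apply: eq_bigr => A _.
by rewrite inE; case: (A != _) => //=; case: (_ == _).
Qed.

Lemma energy_weighted_sum (R : realType) (I : eqType) (r : seq I) (a : I -> R)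
    (f : I -> pattern) X k :
  energy (fun q => \sum_(i <- r) a i * (q == f i)%:R) X k =
  \sum_(i <- r) a i * (occ_count X k (f i))%:R.
Proof.
rewrite /energy exchange_big /=; apply: eq_bigr => i _.
by rewrite -mulr_sumr sum_occ_count.
Qed.

Lemma sum_indicator (R : realType) (I T : eqType) (r : seq I) (a : I -> R)
    (f : I -> T) (q : T) : uniq r -> {in r &, injective f} ->
  (forall i, i \in r -> q = f i -> \sum_(j <- r) a j * (q == f j)%:R = a i) /\
  ((forall i, i \in r -> q <> f i) -> \sum_(j <- r) a j * (q == f j)%:R = 0).
Proof.
move=> ur inj; split=> [i ir ->|nq].
  rewrite (bigD1_seq i)//= eqxx mulr1 big_seq_cond big1 ?addr0// => j.
  case/andP=> jr ji; case: eqP => [/inj E|_]; last by rewrite mulr0.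
  by rewrite E ?eqxx in ji.
rewrite big_seq big1// => j jr.
by case: eqP => [/nq|_]; [move=> /(_ jr)|rewrite mulr0].
Qed.

(** The energies agree outside [P], which leaves a finite sum of counts; [undup] keeps a pattern
    listed twice from being charged twice. *)
Lemma energy_perturbation (R : realType) (Phi Phi' : pattern -> R) lambda P X k :
  perturbation Phi Phi' lambda P ->
  energy Phi' X k = energy Phi X k +
    \sum_(p <- undup P) (Phi' p - Phi p) * (occ_count X k p)%:R.
Proof.
move=> [_ out].
rewrite -(energy_weighted_sum (undup P) (fun p => Phi' p - Phi p) id).
rewrite /energy -big_split /=; apply: eq_bigr => A _.
set q := occ_pattern X A.
have [H1 H2] := sum_indicator (fun p => Phi' p - Phi p) q (undup_uniq P)
  (fun x y _ _ (e : id x = id y) => e).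
have [qP|qP] := boolP (q \in P).
  by rewrite (H1 q) ?mem_undup// addrC subrK.
rewrite H2 ?addr0 ?out// => i iP qi; move: iP; rewrite mem_undup -qi.
exact/negP.
Qed.

(** * Sturmian words and their energy *)

Lemma hit_pair (R : realType) (theta : R) c d y : (0 < d)%N ->
  letter theta c y -> letter theta c (y + d%:R * theta) ->
  hit theta c (pair_pattern d) y.
Proof.
case: d => // d _ l0 l1; apply/allP => j _; rewrite /pair_pattern.
case: j => [|j]; first by rewrite /= mul0r addr0 l0.
rewrite [nth _ _ _]/= nth_rcons size_nseq /= nth_nseq.
by case: ltngtP => // ->; rewrite l1.
Qed.

(** Both letters are ones on the open arc from [theta] to [1 - r], of length at least [l]. The
    counted arc starts [l / 4] after [theta] and has length [l / 2], away from the endpoints for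
    either [c]; the counting error takes another [l / 4]. *)
Lemma pair_count (R : realType) (theta l : R) : irrational theta -> 0 < theta ->
  0 < l -> exists N0 : nat, forall N, (N0 <= N)%N ->
  forall (d : nat) (r : R) (z : int) c u, (0 < d)%N ->
  d%:R * theta = z%:~R + r -> 0 <= r -> r + l <= 1 - theta ->
  l / 4 * N%:R <= \sum_(i < N) (hit theta c (pair_pattern d) (u + i%:R * theta))%:R.
Proof.
move=> irr t0 l0; have l40 : 0 < l / 4 by rewrite divr_gt0.
have [N0 N0p] := arc_count irr l40; exists N0 => N NN d r z c u d0 dz r0 rl.
have l01 : 0 < l / 2 <= 1 by apply/andP; split; lra.
have /andP[+ _] := N0p N NN (u - theta - l / 4) _ l01.
have -> : l / 2 - l / 4 = l / 4 by lra.
move=> H; apply: le_trans H _; apply: ler_sum => i _; rewrite ler_nat.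
case: ltP => //= fl; rewrite lt0b.
have f0 := frac_ge0 (u - theta - l / 4 + i%:R * theta).
have Ey := fracE (u - theta - l / 4 + i%:R * theta).
move: fl f0 Ey; set f := frac _; set F := Num.floor _ => fl f0 Ey.
have one y (w : int) g : y = w%:~R + g -> theta < g < 1 -> letter theta c y.
  move=> yw /andP[g1 g2]; rewrite /letter (@frac_def _ y g w)//; last first.
    by apply/andP; split; lra.
  by case: c; apply/negP => /andP[]; lra.
apply: hit_pair => //.
  by apply: (one _ F (f + theta + l / 4)); [|apply/andP; split]; lra.
by apply: (one _ (F + z) (f + theta + l / 4 + r)); [rewrite intrD|apply/andP; split]; lra.
Qed.

Lemma sturmianP (R : realType) (psi : R) X : sturmian psi X ->
  exists x c, forall n : int, X n = letter psi c (x + n%:~R * psi).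
Proof.
move=> [x [c H]]; exists x, c => n; have /= := H n; rewrite /letter.
set b := (if c then _ else _); case: (X n) b => [] [] //= [h1 h2].
  by have := h2 isT.
by have := h1 erefl.
Qed.

Lemma occurs_hit (R : realType) (psi : R) X x c p (t k : nat) :
  (forall n : int, X n = letter psi c (x + n%:~R * psi)) ->
  occurs X p (t%:Z - k%:Z) = hit psi c p (x - k%:R * psi + t%:R * psi).
Proof.
move=> HX; apply: eq_all => j; case: (nth None p j) => // b.
rewrite HX; congr (letter _ _ _ == _).
by rewrite intrD intrB -!pmulrn; lra.
Qed.

Lemma occ_count_hit (R : realType) (psi : R) X x c p k : canonical p ->
  (forall n : int, X n = letter psi c (x + n%:~R * psi)) ->
  (occ_count X k p)%:R =
  \sum_(t < k.*2.+2 - size p) (hit psi c p (x - k%:R * psi + t%:R * psi))%:R :> R.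
Proof.
move=> cp HX; rewrite occ_count_canonical// natr_sum; apply: eq_bigr => t _.
by rewrite (occurs_hit _ _ _ HX).
Qed.

(** The words enter [hit_compare] only through starting points and endpoint choices, so it applies
    in both directions. *)
Lemma occ_count_compare (R : realType) (phi psi e : R) p X W :
  irrational phi -> irrational psi -> 0 < e -> sturmian phi X -> sturmian psi W ->
  exists k0 : nat, forall k, (k0 <= k)%N ->
  `|(occ_count X k p)%:R - (occ_count W k p)%:R| <=
  (4 * (size p)%:R ^+ 2 * `|phi - psi| + e) * (k.*2.+1)%:R.
Proof.
move=> irr irr' e0 /sturmianP[x [c HX]] /sturmianP[w [c' HW]].
have C0 : 0 <= 4 * (size p)%:R ^+ 2 * `|phi - psi| + e.
  by rewrite addr_ge0// ?mulr_ge0// ltW.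
have [cp|ncp] := boolP (canonical p); last first.
  exists 0%N => k _; rewrite !occ_count_noncanonical// subrr normr0.
  by rewrite mulr_ge0.
have [N1 N1p] := hit_compare p irr irr' e0.
have [N2 N2p] := hit_compare p irr' irr e0.
exists (size p + N1 + N2)%N => k kk; have sp : (0 < size p)%N.
  by case/andP: cp; case: (p).
set N := (k.*2.+2 - size p)%N.
have NN1 : (N1 <= N)%N by rewrite /N; lia.
have NN2 : (N2 <= N)%N by rewrite /N; lia.
have NK : N%:R <= (k.*2.+1)%:R :> R by rewrite ler_nat /N; lia.
rewrite (occ_count_hit _ cp HX) (occ_count_hit _ cp HW) -/N.
have := N1p N NN1 (x - k%:R * phi) (w - k%:R * psi) c c'.
have := N2p N NN2 (w - k%:R * psi) (x - k%:R * phi) c' c.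
rewrite (distrC psi phi).
have := ler_wpM2l C0 NK.
set A := \sum_(i < N) _; set B := \sum_(i < N) _.
set Q := _ * N%:R; set S := _ * _%:R; move=> *.
by rewrite ler_norml; apply/andP; split; lra.
Qed.

(** Distance 0 has to be ruled out because [pair_pattern 0] and [pair_pattern 1] are the same
    word. *)
Lemma forbidden_gt0 (R : realType) (phi : R) d :
  phi < 1 -> forbidden phi d -> (0 < d)%N.
Proof.
case: d => // p1; rewrite /forbidden (@frac_def _ _ 0 0).
- by case/andP; lra.
- by rewrite mul0r mulr0z addr0.
- by rewrite lexx ltr01.
Qed.

Lemma size_pair_pattern d : (0 < d)%N -> size (pair_pattern d) = d.+1.
Proof. by case: d => // d _; rewrite /= size_rcons size_nseq. Qed.

Lemma nth_pair_pattern d : (0 < d)%N -> nth None (pair_pattern d) d = Some true.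
Proof. by case: d => // d _; rewrite /= nth_rcons size_nseq ltnn eqxx. Qed.

Lemma canonical_pair d : (0 < d)%N -> canonical (pair_pattern d).
Proof. by move=> d0; rewrite /canonical size_pair_pattern// nth_pair_pattern. Qed.

Lemma H_alpha_ge0 (R : realType) (phi alpha : R) m p : 0 <= H_alpha phi alpha m p.
Proof.
by rewrite /H_alpha; case: ifP => // _; case: ifP => // _; rewrite invr_ge0 powR_ge0.
Qed.

Lemma H_alpha_pair (R : realType) (phi alpha : R) m d :
  (0 < d)%N -> forbidden phi d ->
  H_alpha phi alpha m (pair_pattern d) = (d%:R `^ alpha)^-1.
Proof.
move=> d0 fd; rewrite /H_alpha size_pair_pattern// ltnS d0 eqxx /=.
by rewrite asboolT//; case: m.
Qed.

Lemma energy_H_alpha_ground (R : realType) (phi alpha : R) m X k :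
  phi < 1 -> admissible phi m X -> energy (H_alpha phi alpha m) X k = 0.
Proof.
move=> p1 [noz nop]; apply: big1 => A A0.
have [_ _ _] := occ_patternP X A0; set i := _ - _.
rewrite /H_alpha; case: eqP => [-> occ|_].
  exfalso; apply: noz; exists i => j jm.
  have := allP occ j; rewrite size_nseq mem_iota /= add0n jm => /(_ isT).
  by rewrite nth_nseq jm => /eqP.
case: ifP => // /andP[/andP[s2 /eqP ep] /asboolP fd] occ.
have d0 := forbidden_gt0 p1 fd; move: occ fd d0; rewrite ep.
set d := (size _).-1 => occ fd d0; exfalso; apply: (nop i _ fd).
have sd : (size (pair_pattern d)).-1 = d by rewrite size_pair_pattern.
rewrite -/d sd; split.
  have := allP occ 0%N; rewrite size_pair_pattern// mem_iota /= => /(_ isT) /eqP.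
  by rewrite addr0.
have := allP occ d; rewrite size_pair_pattern// mem_iota /= add0n ltnSn.
by rewrite nth_pair_pattern// => /(_ isT) /eqP.
Qed.

(** All energies are nonnegative, so every pattern except the pairs at distances in [D] may be
    dropped. *)
Lemma energy_H_alpha_ge (R : realType) (phi alpha : R) m W k (D : seq nat) :
  phi < 1 -> uniq D -> (forall d, d \in D -> forbidden phi d) ->
  \sum_(d <- D) (d%:R `^ alpha)^-1 * (occ_count W k (pair_pattern d))%:R <=
  energy (H_alpha phi alpha m) W k.
Proof.
move=> p1 uD fD; rewrite -energy_weighted_sum; apply: ler_sum => A _.
set q := occ_pattern W A.
have D0 d : d \in D -> (0 < d)%N by move=> /fD; exact: forbidden_gt0.
have inj : {in D &, injective pair_pattern}.
  move=> d e /D0 d0 /D0 e0 /(congr1 size).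
  by rewrite !size_pair_pattern// => -[].
have [H1 H2] := sum_indicator (fun d : nat => (d%:R `^ alpha)^-1) q uD inj.
have [/hasP[d dD /eqP qd]|nq] := boolP (has (fun d => q == pair_pattern d) D).
  by rewrite (H1 d dD qd) qd H_alpha_pair//; [exact: D0|exact: fD].
rewrite H2 ?H_alpha_ge0// => d dD qd; move/hasPn: nq => /(_ d dD).
by rewrite qd eqxx.
Qed.

(* Each distance [d] in [D] occurs between ones with frequency at least [l/4],
   and the occurrences are counted in a window that is at least half of
   [[-k,k]]. *)
Lemma energy_H_alpha_sturmian_ge (R : realType) (phi alpha psi l : R) m W (D : seq nat) :
  phi < 1 -> irrational psi -> 0 < psi -> 0 < l -> sturmian psi W ->
  uniq D -> (forall d, d \in D -> forbidden phi d) ->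
  (forall d, d \in D -> exists (r : R) (z : int),
     [/\ d%:R * psi = z%:~R + r, 0 <= r & r + l <= 1 - psi]) ->
  exists k0 : nat, forall k, (k0 <= k)%N ->
  (\sum_(d <- D) (d%:R `^ alpha)^-1) * (l / 8) * (k.*2.+1)%:R <=
  energy (H_alpha phi alpha m) W k.
Proof.
move=> p1 irr psi0 l0 /sturmianP[w [c HW]] uD fD rD.
have [N0 N0p] := pair_count irr psi0 l0.
exists (N0 + \max_(d <- D) d)%N => k kk.
apply: le_trans (energy_H_alpha_ge _ _ _ _ p1 uD fD).
rewrite -mulrA mulr_suml big_seq [leRHS]big_seq; apply: ler_sum => d dD.
rewrite ler_wpM2l ?invr_ge0 ?powR_ge0//.
have d0 := forbidden_gt0 p1 (fD d dD).
have dk : (d <= \max_(d <- D) d)%N by exact: leq_bigmax_seq.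
rewrite (occ_count_hit _ (canonical_pair d0) HW) size_pair_pattern//.
have [r [z [dz r0 rl]]] := rD d dD.
have NN : (N0 <= k.*2.+2 - d.+1)%N by lia.
apply: le_trans (N0p _ NN d r z c _ d0 dz r0 rl).
have : (k.*2.+1)%:R <= 2 * (k.*2.+2 - d.+1)%:R :> R.
  by rewrite -natrM ler_nat; lia.
set a := _%:R; set b := _%:R => ab; nra.
Qed.

(** * A lower bound of order 1/n for the energy of the competitors *)

Lemma limn_einf_le (R : realType) (u v : nat -> \bar R) (k0 : nat) :
  (forall k, (k0 <= k)%N -> (u k <= v k)%E) -> (limn_einf u <= limn_einf v)%E.
Proof.
move=> uv; rewrite !limn_einf_lim.
apply: lee_lim; [exact: is_cvg_einfs|exact: is_cvg_einfs|].
exists k0 => //= n kn; apply: le_ereal_inf_tmp => /= _ [k /= nk <-].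
apply: le_trans (uv k (leq_trans kn nk)).
by apply: ereal_inf_lbound; exists k.
Qed.

Lemma irrational_subV (R : realType) (phi : R) (n : nat) :
  irrational phi -> irrational (phi - n%:R^-1).
Proof.
move=> irr [q _ qe]; apply: irr; exists (q + n%:R^-1) => //.
by rewrite rmorphD /= fmorphV rmorph_nat qe subrK.
Qed.

Lemma irrational_natM (R : realType) (phi : R) (n : nat) :
  irrational phi -> (0 < n)%N -> irrational (n%:R * phi).
Proof.
move=> irr n0 [q _ qe]; apply: irr; exists (n%:R^-1 * q) => //.
by rewrite rmorphM /= fmorphV rmorph_nat qe mulKf// pnatr_eq0 -lt0n.
Qed.

Lemma forbidden_itv (R : realType) (phi f : R) d (F : int) : phi < 1 ->
  0 <= f <= 2 * phi - 1 -> d%:R * phi = F%:~R + (1 - phi) + f -> forbidden phi d.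
Proof.
move=> p1 /andP[f0 f1] dF; rewrite /forbidden (@frac_def _ _ (1 - phi + f) F).
- by apply/andP; split; lra.
- by rewrite dF -addrA.
- by apply/andP; split; lra.
Qed.

(** The threshold [k0] may depend on the word, but the rate [v] may not. *)
Definition min_rate (R : realType) (phi alpha psi v : R) : Prop :=
  forall m W, sturmian psi W -> exists k0 : nat, forall k, (k0 <= k)%N ->
    v * (k.*2.+1)%:R <= energy (H_alpha phi alpha m) W k.

Lemma min_rate_le (R : realType) (phi alpha psi v v' : R) :
  v' <= v -> min_rate phi alpha psi v -> min_rate phi alpha psi v'.
Proof.
move=> vv H m W HW; have [k0 k0p] := H m W HW; exists k0 => k /k0p.
by apply: le_trans; rewrite ler_wpM2r.
Qed.

(* At distances [d] divisible by [n] the rotations by [phi] and [phi - 1/n]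
   agree, but the second one leaves [1/n] more room for the ones. *)
Lemma min_rate_each (R : realType) (phi alpha : R) (n : nat) :
  irrational phi -> 2^-1 < phi < 1 -> (0 < n)%N -> 0 < phi - n%:R^-1 ->
  exists2 v, 0 < v & min_rate phi alpha (phi - n%:R^-1) v.
Proof.
move=> irr /andP[p2 p1] n0 psi0.
have nr0 : 0 < n%:R :> R by rewrite ltr0n.
have i0 : 0 < n%:R^-1 :> R by rewrite invr_gt0.
(* The first bound keeps [j n phi] in the forbidden arc; the second uses at most half of the extra
   room [1/n], leaving [l = 1/(2n)]. *)
have e0 : 0 < Num.min (2 * phi - 1) (n%:R^-1 / 2).
  by rewrite lt_min; apply/andP; split; lra.
have [L Lp] := rotation_dense (irrational_natM irr n0) e0.
have [j _] := Lp (phi - 1); set f := frac _; rewrite lt_min => /andP[f1 f2].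
have f0 : 0 <= f by exact: frac_ge0.
have Ef := fracE (phi - 1 + j%:R * (n%:R * phi)); rewrite -/f in Ef.
set F := Num.floor _ in Ef.
have jn : (j * n)%N%:R * phi = F%:~R + (1 - phi) + f by rewrite natrM; lra.
have fd : forbidden phi (j * n).
  by apply: forbidden_itv jn => //; apply/andP; split; lra.
have d0 := forbidden_gt0 p1 fd.
exists (((j * n)%N%:R `^ alpha)^-1 * (n%:R^-1 / 2 / 8)).
  by rewrite mulr_gt0 ?divr_gt0// invr_gt0 powR_gt0// ltr0n.
move=> m W HW.
have := @energy_H_alpha_sturmian_ge _ phi alpha (phi - n%:R^-1) (n%:R^-1 / 2) m W
  [:: (j * n)%N] p1 (irrational_subV irr) psi0 _ HW.
rewrite big_seq1; apply => //.
- by rewrite divr_gt0.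
- by move=> d; rewrite inE => /eqP ->.
- move=> d; rewrite inE => /eqP ->; exists (1 - phi + f), (F - j%:Z); split.
  + rewrite mulrBr jn natrM mulfK ?gt_eqF// intrB -pmulrn; lra.
  + lra.
  + lra.
Qed.

(* For large [n], the distances [d] in [[2h, 3h)] with [h ~ n/M] shift the
   rotation by [d/n ~ 2/M], so those with [d phi] just above [1 - phi] fall
   inside the interval of ones; there are about [n] of them and each costs at
   least [d^-2 ~ n^-2], which is where [alpha <= 2] enters. *)
Lemma min_rate_large (R : realType) (phi alpha : R) :
  irrational phi -> 2^-1 < phi < 1 -> 1 < alpha <= 2 ->
  exists (n0 : nat) (c : R), 0 < c /\ forall n, (n0 <= n)%N ->
    0 < phi - n%:R^-1 -> min_rate phi alpha (phi - n%:R^-1) (c / n%:R).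
Proof.
move=> irr /andP[p2 p1] /andP[a1 a2].
(* With [del = 1/M], the bound [3 * del <= 1 - phi] keeps the shifted remainder nonnegative, and
   [del <= 2 * phi - 1] makes the selected distances forbidden. *)
have [M0 M0p] := ceil_natP (3 / (1 - phi) + 1 / (2 * phi - 1)).
pose M := M0.+1; pose del : R := M%:R^-1.
have Mr0 : 0 < M%:R :> R by rewrite ltr0n.
have del0 : 0 < del by rewrite invr_gt0.
have q1 : 0 < 1 - phi by lra.
have q2 : 0 < 2 * phi - 1 by lra.
have MM : 3 / (1 - phi) + 1 / (2 * phi - 1) <= M%:R.
  by apply: le_trans M0p _; rewrite ler_nat.
have M1 : 3 * del <= 1 - phi.
  have H : 3 / (1 - phi) <= M%:R.
    by apply: le_trans MM; rewrite lerDl divr_ge0// ltW.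
  by rewrite ler_pdivrMr// mulrC -ler_pdivrMr// in H.
have M2 : del <= 2 * phi - 1.
  have H : 1 / (2 * phi - 1) <= M%:R.
    by apply: le_trans MM; rewrite lerDr divr_ge0// ltW.
  by rewrite ler_pdivrMr// mulrC -ler_pdivrMr// div1r in H.
have e0 : 0 < del / 4 by rewrite divr_gt0.
have [N0 N0p] := arc_count irr e0.
(* In the constant, 9 comes from [d <= 3 * h], 4 from the number of selected distances and 8 from
   the frequency of pairs. *)
exists (M * (N0 + 4))%N, (del / (9 * 4 * 8)); split; first by rewrite divr_gt0// !mulr_gt0.
move=> n nn psi0 m W HW.
pose h := (n %/ M)%N.
have hN0 : (N0 + 4 <= h)%N by rewrite /h leq_divRL// mulnC.
have hn : (h * M <= n)%N by exact: leq_trunc_div.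
have nh : (n < h.+1 * M)%N by rewrite /h ltn_ceil.
have h0 : (0 < h)%N by rewrite (leq_trans _ hN0)// addn4.
have nr0 : 0 < n%:R :> R by rewrite ltr0n (leq_trans _ hn)// muln_gt0 h0.
have hr0 : 0 < h%:R :> R by rewrite ltr0n.
have i0 : 0 < n%:R^-1 :> R by rewrite invr_gt0.
have hdel : h%:R <= n%:R * del.
  by rewrite -ler_pdivrMr// invrK -natrM ler_nat.
have delh : n%:R * del <= h%:R + 1.
  by rewrite natr1 -ler_pdivlMr// invrK -natrM ler_nat ltnW.
have h4 : 4 <= h%:R :> R by rewrite ler_nat (leq_trans _ hN0)// leq_addl.
have hN : (N0 <= h)%N by rewrite (leq_trans _ hN0)// leq_addr.
have h3 : (3 * h = h.*2 + h)%N by rewrite mulSn mul2n addnC.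
clearbody h; clear nn hN0 hn nh.
pose sel d := frac (d%:R * phi - (1 - phi)) < del / 2.
pose D := [seq d <- iota (h.*2) h | sel d].
have DP d : d \in D -> [/\ (h.*2 <= d)%N, (d < 3 * h)%N & sel d].
  by rewrite mem_filter mem_iota => /andP[-> /andP[-> ?]]; split=> //; rewrite h3.
have H := @energy_H_alpha_sturmian_ge _ phi alpha (phi - n%:R^-1) del m W D p1
  (irrational_subV irr) psi0 del0 HW (filter_uniq _ (iota_uniq _ _)).
have [|d dD|k0 k0p] := H.
- move=> d /DP[_ _]; rewrite /sel => fd.
  have Ed := fracE (d%:R * phi - (1 - phi)).
  apply: (@forbidden_itv _ _ (frac (d%:R * phi - (1 - phi))) _
    (Num.floor (d%:R * phi - (1 - phi)))) => //.
    by rewrite frac_ge0 /=; lra.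
  lra.
- have [d1 d2 fd] := DP d dD; rewrite /sel in fd.
  have Ed := fracE (d%:R * phi - (1 - phi)).
  have f0 := frac_ge0 (d%:R * phi - (1 - phi)).
  move: fd Ed f0; set f := frac _; set F := Num.floor _ => fd Ed f0.
  have dn1 : d%:R * n%:R^-1 <= 3 * del.
    rewrite ler_pdivrMr//; have : d%:R <= 3 * h%:R :> R.
      by rewrite -natrM ler_nat ltnW.
    lra.
  (* Here [4 <= h] absorbs the rounding in [h], through [3/2 (h + 1) <= 2 h]. The shift then exceeds
     [f] by at least [del], which is the room required. *)
  have dn2 : 3 / 2 * del <= d%:R * n%:R^-1.
    rewrite ler_pdivlMr//; have : 2 * h%:R <= d%:R :> R.
      by rewrite -natrM ler_nat mul2n.
    lra.
  exists (1 - phi + f - d%:R * n%:R^-1), F; split; lra.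
exists k0 => k /k0p; apply: le_trans; rewrite ler_wpM2r//.
(* At least [del / 4 * h] distances are selected, each costing at least [(3h)^-2]. *)
have key : (9 * h%:R ^+ 2)^-1 * (del / 4 * h%:R) <= \sum_(d <- D) (d%:R `^ alpha)^-1.
  have del1 : del <= 1 by lra.
  have l01 : 0 < del / 2 <= 1 by apply/andP; split; lra.
  have /andP[cnt _] := N0p h hN ((h.*2)%:R * phi - (1 - phi)) _ l01.
  have {}cnt : del / 4 * h%:R <= \sum_(i < h) (sel (h.*2 + i)%N)%:R.
    have -> : del / 4 = del / 2 - del / 4 by lra.
    apply: le_trans cnt _; apply: ler_sum => i _; rewrite /sel.
    have -> : (h.*2 + i)%:R * phi - (1 - phi) =
      (h.*2)%:R * phi - (1 - phi) + i%:R * phi by rewrite natrD; lra.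
    exact: lexx.
  have c9 : 0 <= (9 * h%:R ^+ 2)^-1 :> R by rewrite invr_ge0 mulr_ge0// exprn_ge0// ltW.
  apply: le_trans (ler_wpM2l c9 cnt) _.
  have -> : D = [seq d <- [seq (h.*2 + i)%N | i <- index_iota 0 h] | sel d].
    by rewrite /D /index_iota subn0 -iotaDl addn0.
  rewrite mulr_sumr big_filter big_map big_mkord.
  rewrite [leRHS]big_mkcond /=; apply: ler_sum => i _.
  case: (sel _) => /=; last by rewrite mulr0.
  rewrite mulr1; set d := (h.*2 + i)%N.
  have d0 : (0 < d)%N by rewrite /d addn_gt0 double_gt0 h0.
  have dr1 : 1 <= d%:R :> R by rewrite ler1n.
  rewrite lef_pV2 ?posrE ?powR_gt0 ?ltr0n//; last first.
    by rewrite mulr_gt0// exprn_gt0.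
  apply: le_trans (ler_powR dr1 a2) _.
  rewrite powR_mulrn ?ler0n//.
  have d3 : d%:R <= 3 * h%:R :> R.
    by rewrite -natrM ler_nat /d h3 leq_add2l ltnW.
  have -> : 9 * h%:R ^+ 2 = (3 * h%:R) ^+ 2 :> R by ring.
  by rewrite lerXn2r// nnegrE ?mulr_ge0.
have del8 : 0 <= del / 8 by rewrite divr_ge0// ltW.
apply: le_trans (ler_wpM2r del8 key).
have -> : (9 * h%:R ^+ 2)^-1 * (del / 4 * h%:R) * (del / 8) =
  del / (9 * 4 * 8) * (del / h%:R).
  by field; rewrite gt_eqF.
(* What remains is [1/n <= del / h], that is [h <= n * del]. *)
apply: ler_wpM2l; first by rewrite divr_ge0// ltW.
by rewrite ler_pdivlMr// ler_pdivrMl.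
Qed.

(** Only finitely many [n] lie below the threshold of [min_rate_large]; induction on that threshold
    takes the minimum of their individual rates. *)
Lemma min_rate_uniform (R : realType) (phi alpha : R) :
  irrational phi -> 2^-1 < phi < 1 -> 1 < alpha <= 2 ->
  exists2 c : R, 0 < c & forall n, (0 < n)%N -> 0 < phi - n%:R^-1 ->
    min_rate phi alpha (phi - n%:R^-1) (c / n%:R).
Proof.
move=> irr phi01 alpha12.
have [n0 [c [c0 large]]] := min_rate_large irr phi01 alpha12.
suff [c' c'0 small] : exists2 c' : R, 0 < c' & forall n, (n < n0)%N -> (0 < n)%N ->
    0 < phi - n%:R^-1 -> min_rate phi alpha (phi - n%:R^-1) (c' / n%:R).
  exists (Num.min c c'); first by rewrite lt_min c0.
  move=> n n_gt0 psi0.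
  have [nn|nn] := ltnP n n0.
    apply: min_rate_le (small n nn n_gt0 psi0).
    by rewrite ler_wpM2r ?invr_ge0// ge_min lexx orbT.
  apply: min_rate_le (large n nn psi0).
  by rewrite ler_wpM2r ?invr_ge0// ge_min lexx.
elim: n0 {large} => [|n0 [c' c'0 IH]]; first by exists 1.
have [n00|] := posnP n0.
  by exists 1 => // n; rewrite n00 ltnS leqn0 => /eqP ->.
move=> n0_gt0; have [psi0|psi0] := ltP 0 (phi - n0%:R^-1); last first.
  exists c' => // n; rewrite ltnS leq_eqVlt => /predU1P[-> _|nn]; last exact: IH.
  by move=> /lt_le_trans /(_ psi0); rewrite ltxx.
have [v v0 rate] := min_rate_each alpha irr phi01 n0_gt0 psi0.
exists (Num.min c' v); first by rewrite lt_min c'0.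
move=> n nn n_gt0 psin; have nr1 : 1 <= n%:R :> R by rewrite ler1n.
have [E|nn0] := eqVneq n n0.
  rewrite E; apply: min_rate_le rate; rewrite -E ler_pdivrMr ?ltr0n//.
  rewrite ge_min; apply/orP; right; nra.
have {}nn : (n < n0)%N by rewrite ltn_neqAle nn0 -ltnS.
apply: min_rate_le (IH n nn n_gt0 psin).
by rewrite ler_wpM2r ?invr_ge0// ge_min lexx.
Qed.

(** * Stability: weighing the perturbation against the energy *)

Lemma eventually_all (T : eqType) (s : seq T) (Q : T -> nat -> Prop) :
  (forall p, p \in s -> exists k0, forall k, (k0 <= k)%N -> Q p k) ->
  exists k0, forall k, (k0 <= k)%N -> forall p, p \in s -> Q p k.
Proof.
elim: s => [|p s IH] H; first by exists 0%N.
have [k1 k1p] := H p (mem_head _ _).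
have [k2 k2p] := IH (fun q qs => H q (@mem_behead _ (p :: s) q qs)).
exists (maxn k1 k2) => k; rewrite geq_max => /andP[kk1 kk2] q.
by rewrite inE => /predU1P[->|]; [exact: k1p|exact: k2p].
Qed.

Unset Implicit Arguments.

Theorem theorem4p8 (R : realType) (phi alpha : R) (m : nat) (X : config)
  (Hirr : irrational phi) (Hphi : 2^-1 < phi < 1) (Halpha : 1 < alpha <= 2)
  (Hm : forall Y : config, admissible phi m Y <-> sturmian phi Y)
  (HX : sturmian phi X) :
  stable (H_alpha phi alpha m) (S_class phi) X.
Proof.
move=> P; have [c c0 rate] := min_rate_uniform Hirr Hphi Halpha.
have /andP[_ p1] := Hphi.
(* The constant of [occ_count_compare] times [n], when the angle difference and the error are both
   [1/n]. *)
pose C (p : pattern) : R := 4 * (size p)%:R ^+ 2 + 1.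
have C0 p : 0 <= C p by rewrite /C addr_ge0// mulr_ge0// exprn_ge0.
pose S := \sum_(p <- undup P) C p.
have S0 : 0 <= S by exact: sumr_ge0.
(* Gain and cost both scale as [1/n], so [lambda] need not depend on [n]; the 1 keeps the
   denominator positive when [P] is empty. *)
exists (c / (1 + S)); first by rewrite divr_gt0//; lra.
move=> Phi' pert W [n [n1 [psi0 HW]]].
have i0 : 0 < n%:R^-1 :> R by rewrite invr_gt0 ltr0n.
have [k1 k1p] := rate n n1 psi0 m W HW.
have [k2 k2p] : exists k2, forall k, (k2 <= k)%N -> forall p, p \in undup P ->
    `|(occ_count X k p)%:R - (occ_count W k p)%:R| <=
    C p / n%:R * (k.*2.+1)%:R :> R.
  apply: eventually_all => p _.
  have [k0 k0p] := occ_count_compare p Hirr (irrational_subV Hirr) i0 HX HW.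
  exists k0 => k /k0p; rewrite subKr (ger0_norm (ltW i0)).
  by rewrite [C p / _]mulrDl mul1r.
apply: (@limn_einf_le _ _ _ (maxn k1 k2)) => k; rewrite geq_max => /andP[kk1 kk2].
rewrite lee_fin ler_wpM2r ?invr_ge0//.
rewrite !(energy_perturbation _ _ pert) (energy_H_alpha_ground alpha k p1 ((Hm X).2 HX)).
rewrite add0r -lerBlDr -sumrB; apply: le_trans (k1p k kk1).
apply: (@le_trans _ _ (\sum_(p <- undup P) c / (1 + S) * (C p / n%:R * (k.*2.+1)%:R))).
  rewrite big_seq [leRHS]big_seq; apply: ler_sum => p pP.
  rewrite -mulrBr; apply: le_trans (ler_norm _) _; rewrite normrM.
  apply: ler_pM => //; last exact: k2p.
  by rewrite distrC ltW//; apply: pert.1; rewrite -mem_undup.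
(* The total gain per site, at most [lambda * S / n], stays below the cost [c / n]. *)
have cS : c / (1 + S) * S <= c by rewrite mulrAC ler_pdivrMr; nra.
rewrite -mulr_sumr -!mulr_suml -/S !mulrA -!(mulrA _ n%:R^-1).
by apply: ler_wpM2r cS; rewrite mulr_ge0// ltW.
Qed.
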